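(* Let $G$ be a simple connected undirected graph with $n$ vertices and resistance degrees $R_1,\dots,R_n$. Then $$E_R(G)\ge 2\sqrt{\frac1n\sum_{i=1}^n R_i^2},$$ and equality holds if and only if $G$ is resistance regular.
   Context: For a connected graph $G$ with vertices $v_1,\dots,v_n$, Laplacian matrix $L$ (degree matrix minus adjacency matrix) and Moore-Penrose inverse $L^\dagger=(l^\dagger_{ij})$, the resistance distance is $r_{ij}=l^\dagger_{ii}+l^\dagger_{jj}-2l^\dagger_{ij}$, and the resistance distance matrix is $R(G)=(r_{ij})_{n\times n}$. The resistance degrees are the row sums $R_i=\sum_{j=1}^n r_{ij}$, and $G$ is resistance regular if all $R_i$ are equal. The resistance energy $E_R(G)$ is $\sum_{i=1}^n|\rho_i(G)|$, where $\rho_1(G),\dots,\rho_n(G)$ are the eigenvalues of $R(G)$ counted with multiplicity. *)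

(* Defs.v *)
From mathcomp Require Import all_boot all_order all_algebra.
From mathcomp Require Import complex reals.

Set Implicit Arguments.
Unset Strict Implicit.
Unset Printing Implicit Defensive.

Import Order.TTheory GRing.Theory Num.Theory.
Local Open Scope ring_scope.

Section MoorePenrose.
Variable F : realFieldType.

(* The four Penrose equations, for real matrices. *)
Definition is_moore_penrose m n (A : 'M[F]_(m, n)) (X : 'M[F]_(n, m)) : Prop :=
  [/\ A *m X *m A = A,
      X *m A *m X = X,
      (A *m X)^T = A *m X
    & (X *m A)^T = X *m A].

(* With the full-rank factorization A = C *m B, where C = col_base A and
   B = row_base A, the Moore-Penrose inverse is B^T (B B^T)^-1 (C^T C)^-1 C^T.
   This is not MathComp's pinvmx, which is only a one-sided partial inverse. *)
Definition mpinv m n (A : 'M[F]_(m, n)) : 'M[F]_(n, m) :=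
  let C := col_base A in let B := row_base A in
  B^T *m invmx (B *m B^T) *m (invmx (C^T *m C) *m C^T).

Lemma gram_unit m n (B : 'M[F]_(m, n)) : row_free B -> B *m B^T \in unitmx.
Proof.
move=> freeB; rewrite -row_free_unit -kermx_eq0; apply/rowV0P => x /sub_kermxP.
move=> xBB; apply: (row_free_inj freeB); rewrite mul0mx.
have : ((x *m B) *m (x *m B)^T) 0 0 = 0.
  by rewrite trmx_mul mulmxA -(mulmxA x) xBB mul0mx mxE.
rewrite mxE => /eqP; rewrite psumr_eq0; last first.
  by move=> j _; rewrite !mxE -expr2 sqr_ge0.
move=> /allP sum0; apply/rowP => j; rewrite [RHS]mxE; apply/eqP.
by have := sum0 j (mem_index_enum j); rewrite [_^T _ _]mxE -expr2 sqrf_eq0.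
Qed.

Lemma mpinvP m n (A : 'M[F]_(m, n)) : is_moore_penrose A (mpinv A).
Proof.
rewrite /mpinv; set C := col_base A; set B := row_base A.
have uB : B *m B^T \in unitmx by apply/gram_unit/row_base_free.
have uC : C^T *m C \in unitmx.
  have := @gram_unit _ _ C^T; rewrite trmxK; apply.
  by rewrite /row_free mxrank_tr; have := col_base_full A; rewrite /row_full.
have : A = C *m B by rewrite mulmx_base.
move: uB uC; clearbody B C; move: (\rank A) B C => r B C uB uC defA.
set GB := invmx (B *m B^T); set GC := invmx (C^T *m C).
have sGB : GB^T = GB by rewrite /GB trmx_inv trmx_mul trmxK.
have sGC : GC^T = GC by rewrite /GC trmx_inv trmx_mul trmxK.
have AX : A *m (B^T *m GB *m (GC *m C^T)) = C *m GC *m C^T.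
  by rewrite defA !mulmxA -(mulmxA C B) -(mulmxA C _ GB) mulmxV // mulmx1.
have XA : B^T *m GB *m (GC *m C^T) *m A = B^T *m GB *m B.
  rewrite defA !mulmxA -(mulmxA _ C^T C) -(mulmxA _ GC) mulVmx // mulmx1 //.
split.
- by rewrite AX {1}defA !mulmxA -(mulmxA _ C^T C) -(mulmxA _ GC) mulVmx // mulmx1.
- by rewrite XA !mulmxA -(mulmxA _ B B^T) -(mulmxA _ (B *m B^T) GB) mulmxV // mulmx1.
- by rewrite AX !trmx_mul trmxK sGC mulmxA.
- by rewrite XA !trmx_mul trmxK sGB mulmxA.
Qed.

Lemma moore_penrose_unique m n (A : 'M[F]_(m, n)) X Y :
  is_moore_penrose A X -> is_moore_penrose A Y -> X = Y.
Proof.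
move=> [AXA XAX AXt XAt] [AYA YAY AYt YAt].
have eAX : A *m X = A *m Y.
  by rewrite -[in LHS]AYA -mulmxA -AYt -AXt -trmx_mul mulmxA AXA AYt.
have eXA : X *m A = Y *m A.
  rewrite -[in LHS]AYA -mulmxA mulmxA -XAt -YAt -trmx_mul.
  by rewrite -mulmxA (mulmxA A) AXA YAt.
by rewrite -XAX eXA -mulmxA eAX mulmxA YAY.
Qed.

End MoorePenrose.

Section Energy.
Variable R : rcfType.

(* The n eigenvalues, counted with algebraic multiplicity: the complex roots of
   the characteristic polynomial. *)
Definition eigenvalues n (A : 'M[R]_n) : seq R[i] :=
  sval (closed_field_poly_normal (char_poly (map_mx (real_complex R) A))).

Lemma eigenvaluesP n (A : 'M[R]_n) :
  char_poly (map_mx (real_complex R) A)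
    = \prod_(z <- eigenvalues A) ('X - z%:P).
Proof.
rewrite /eigenvalues; case: closed_field_poly_normal => r /= {1}->.
by rewrite (monicP (char_poly_monic _)) scale1r.
Qed.

Definition energy n (A : 'M[R]_n) : R :=
  \sum_(z <- eigenvalues A) ComplexField.Normc.normc z.

End Energy.

Section Resistance.
Variables (R : rcfType) (n : nat) (e : rel 'I_n).

Definition connected_graph : Prop := forall x y : 'I_n, connect e x y.

Definition adjacency_mx : 'M[R]_n := \matrix_(i, j) (e i j)%:R.

Definition degree_mx : 'M[R]_n := diag_mx (\row_i #|[set j | e i j]|%:R).

Definition laplacian : 'M[R]_n := degree_mx - adjacency_mx.

Definition resistance_mx : 'M[R]_n :=
  let Ld := mpinv laplacian in
  \matrix_(i, j) (Ld i i + Ld j j - 2 * Ld i j).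

Definition resistance_degree (i : 'I_n) : R := \sum_j resistance_mx i j.

Definition resistance_regular : Prop :=
  forall i j : 'I_n, resistance_degree i = resistance_degree j.

Definition resistance_energy : R := energy resistance_mx.

End Resistance.

(* Main.v *)
Require Import Defs.
From mathcomp Require Import all_boot all_order all_algebra.
From mathcomp Require Import complex reals ring.

(** Let [L] be the Laplacian, [X] its Moore-Penrose inverse, [M] the resistance
    matrix and [u] the all-ones vector.  Connectedness makes [L] positive
    semidefinite with kernel spanned by [u], hence [X] is positive definite on
    the vectors orthogonal to [u].  Since [M = g u^T + u g^T - 2 X] with [g]
    the diagonal of [X], the matrix [M] is negative definite on the orthogonal
    complement of [u] ([resistance_form_lt0]).

    Two eigenvectors of [M] for nonnegative eigenvalues would have a nonzero
    combination orthogonal to [u], where the form is nonnegative; so at most one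
    eigenvalue of [M] is nonnegative.  The trace of [M] is zero, so there is
    exactly one, say [rho], the others are negative with sum [- rho], and the
    energy is [2 rho] ([energy_one_nonneg]).  All eigenvalues being at most
    [rho] in absolute value, [|M u|^2 <= rho^2 |u|^2], that is,
    [sum_i R_i^2 <= n rho^2]: this is the inequality.

    If [n] is not 2, the negative eigenvalues are strictly smaller than [rho] in
    absolute value, so equality forces [u] to be an eigenvector for [rho]: the
    row sums are constant.  For [n = 2] the row sums always agree.  Conversely,
    if [u] is an eigenvector, its eigenvalue is [rho]: otherwise the eigenvector
    for [rho] would be orthogonal to [u], forcing [rho < 0].

    The argument on eigenvalues applies to every symmetric matrix with zero
    diagonal that is negative definite on the complement of [u]
    ([energy_row_sums]).  It is carried out in a unitary eigenbasis over [R[i]],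
    which is harmless because a real definite form remains definite as a
    Hermitian form ([neg_def_complex]). *)

Import Order.TTheory GRing.Theory Num.Theory.
Local Open Scope ring_scope.
Local Open Scope sesquilinear_scope.

(** * Unitary diagonalization of real symmetric matrices *)

Section Diagonalization.
Variable R : rcfType.
Local Notation C := R[i].
Local Notation toC := (map_mx (real_complex R)).
Local Notation normc := ComplexField.Normc.normc.

Lemma normc_real (x : R) : normc (x%:C)%C = `|x|.
Proof. by rewrite /= expr0n addr0 sqrtr_sqr. Qed.

Lemma normc_sqr (z : C) : ((normc z ^+ 2)%:C)%C = z * z^*.
Proof. by rewrite rmorphXn -normCK. Qed.

Lemma normc_sqr_eq0 (z : C) : (normc z ^+ 2 == 0) = (z == 0).
Proof.
rewrite sqrf_eq0; apply/eqP/eqP => [/ComplexField.Normc.eq0_normc//|->].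
exact: ComplexField.Normc.normc0.
Qed.

Lemma conj_toC m n (A : 'M[R]_(m, n)) : (toC A)^t* = toC A^T.
Proof. by apply/matrixP=> i j; rewrite !mxE conj_Creal // complex_real. Qed.

(** The spectral theorem for real symmetric matrices: the eigenvalues [d] are
    real, while the orthonormal eigenvectors (the rows of [P]) are taken over the
    complex numbers. *)
Lemma symmetric_diagonalization n (A : 'M[R]_n) : A^T = A ->
  exists (P : 'M[C]_n) (d : 'rV[R]_n),
    P \is unitarymx /\ toC A = P^t* *m diag_mx (toC d) *m P.
Proof.
move=> Asym.
have hA : toC A \is hermsymmx.
  by apply/is_hermitianmxP; rewrite expr0 scale1r conj_toC Asym.
have uP := spectral_unitarymx (toC A).
exists (spectralmx (toC A)), (map_mx (@complex.Re R) (spectral_diag (toC A))).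
split=> //; rewrite [LHS](orthomx_spectralP (hermitian_normalmx hA)).
rewrite invmx_unitary //; congr (_ *m diag_mx _ *m _).
apply/rowP=> j; rewrite !mxE RRe_real //.
by have /mxOverP := hermitian_spectral_diag_real hA; apply.
Qed.

(** In the unitary eigenbasis formed by the rows of [P], the coordinates of a
    column [u] are the entries of [P *m u]. *)
Section Coordinates.
Variables (n : nat) (A : 'M[R]_n) (P : 'M[C]_n) (d : 'rV[R]_n).
Hypothesis uP : P \is unitarymx.
Hypothesis defA : toC A = P^t* *m diag_mx (toC d) *m P.

Let PPt : P *m P^t* = 1%:M. Proof. exact/unitarymxP. Qed.
Let PtP : P^t* *m P = 1%:M. Proof. exact: mulmx1C. Qed.

Lemma char_poly_diagonalization :
  char_poly (toC A) = \prod_(k < n) ('X - ((d 0 k)%:C)%C%:P).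
Proof.
set Q := map_mx polyC P; set Q' := map_mx polyC (P^t*).
have Q'Q : Q' *m Q = 1%:M by rewrite -map_mxM PtP map_mx1.
have -> : char_poly (toC A) = \det (Q' *m char_poly_mx (diag_mx (toC d)) *m Q).
  rewrite /char_poly /char_poly_mx mulmxBr mulmxBl -!map_mxM -defA.
  by rewrite scalar_mxC -mulmxA Q'Q mulmx1.
rewrite !det_mulmx mulrAC -det_mulmx Q'Q det1 mul1r -/(char_poly _).
rewrite char_poly_trig ?diag_mx_is_trig //.
by apply: eq_bigr => k _; rewrite !mxE eqxx.
Qed.

Lemma trace_diagonalization : \tr A = \sum_k d 0 k.
Proof.
apply: (@complexI R); rewrite -trace_map_mx defA.
rewrite -mulmxA mxtrace_mulC -mulmxA PPt mulmx1 mxtrace_diag rmorph_sum.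
by apply: eq_bigr => k _; rewrite mxE.
Qed.

Lemma energy_diagonalization : energy A = \sum_k `|d 0 k|.
Proof.
have /prod_XsubC_eq eig : \prod_(z <- eigenvalues A) ('X - z%:P)
    = \prod_(z <- [seq ((d 0 k)%:C)%C | k <- enum 'I_n]) ('X - z%:P).
  by rewrite -eigenvaluesP char_poly_diagonalization big_map big_enum.
rewrite /energy (perm_big _ eig) big_map big_enum /=.
by apply: eq_bigr => k _; rewrite -normc_real.
Qed.

Lemma parseval (u : 'cV[R]_n) :
  \sum_k normc ((P *m toC u) k 0) ^+ 2 = \sum_i u i 0 ^+ 2.
Proof.
have sqnorm (v : 'cV[C]_n) :
    (v^t* *m v) 0 0 = ((\sum_k normc (v k 0) ^+ 2)%:C)%C.
  rewrite mxE rmorph_sum; apply: eq_bigr => k _.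
  by rewrite !mxE mulrC -normc_sqr.
apply: (@complexI R); rewrite -sqnorm trmx_mul map_mxM conj_toC.
rewrite mulmxA -(mulmxA _ _ P) PtP mulmx1 -map_mxM !mxE.
by congr (_%:C)%C; apply: eq_bigr => k _; rewrite !mxE expr2.
Qed.

Lemma diag_coord (u : 'cV[R]_n) k :
  (P *m toC (A *m u)) k 0 = ((d 0 k)%:C)%C * (P *m toC u) k 0.
Proof.
rewrite map_mxM defA !mulmxA PPt mul1mx -mulmxA mul_diag_mx mxE.
by rewrite mxE.
Qed.

(** The value of the Hermitian form of [A] at the vector with coordinates [y] in
    the eigenbasis. *)
Lemma quadratic_form_coord (y : 'rV[C]_n) :
  ((y *m P) *m toC A *m (y *m P)^t*) 0 0
    = ((\sum_k d 0 k * normc (y 0 k) ^+ 2)%:C)%C.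
Proof.
rewrite defA trmx_mul map_mxM !mulmxA -(mulmxA y) PPt mulmx1.
rewrite -(mulmxA _ P) PPt mulmx1 mul_mx_diag mxE rmorph_sum.
by apply: eq_bigr => k _; rewrite !mxE mulrAC -normc_sqr -rmorphM mulrC.
Qed.

End Coordinates.

(** Writing a complex vector as [a + i b] with [a] and [b] real, the Hermitian form
    of a real symmetric matrix at it is the sum of the quadratic forms at [a] and
    [b], the cross terms cancelling by symmetry. *)
Lemma neg_def_complex n (A : 'M[R]_n) (u : 'cV[R]_n) : A^T = A ->
  (forall x : 'rV[R]_n, x != 0 -> x *m u = 0 -> (x *m A *m x^T) 0 0 < 0) ->
  forall w : 'rV[C]_n, w != 0 -> w *m toC u = 0 ->
    (w *m toC A *m w^t*) 0 0 < 0.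
Proof.
move=> Asym negA w w0 wu.
pose a : 'rV[R]_n := map_mx (@complex.Re R) w.
pose b : 'rV[R]_n := map_mx (@complex.Im R) w.
have defw : w = toC a + 'i *: toC b.
  by apply/rowP=> j; rewrite !mxE -complexiE -complexE.
have wuE : w *m toC u = toC (a *m u) + 'i *: toC (b *m u).
  by rewrite defw mulmxDl -scalemxAl !map_mxM.
have au : a *m u = 0.
  apply/matrixP=> i j; have := congr1 (fun M : 'M[C]__ => complex.Re (M i j)) wuE.
  by rewrite wu !mxE -complexiE /=; simpc => /= <-.
have bu : b *m u = 0.
  apply/matrixP=> i j; have := congr1 (fun M : 'M[C]__ => complex.Im (M i j)) wuE.
  by rewrite wu !mxE -complexiE /=; simpc => /= <-.
have qE : (w *m toC A *m w^t*) 0 0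
    = (((a *m A *m a^T) 0 0 + (b *m A *m b^T) 0 0)%:C)%C.
  have sab : b *m A *m a^T = a *m A *m b^T.
    transitivity (b *m A *m a^T)^T; last by rewrite !trmx_mul trmxK Asym mulmxA.
    by apply/matrixP=> i j; rewrite [RHS]mxE !ord1.
  have -> : w^t* = toC a^T - 'i *: toC b^T.
    by rewrite defw linearD linearZ map_mxD map_mxZ /= conjCi scaleNr !conj_toC.
  rewrite defw mulmxDl -scalemxAl mulmxBr !mulmxDl -!scalemxAl -!scalemxAr.
  rewrite -!map_mxM sab.
  move: (a *m A *m a^T) (a *m A *m b^T) (b *m A *m b^T) => p q r.
  rewrite !mxE rmorphD /=.
  have := sqrCi R[i]; move: 'i => I I2.
  ring: I2.
rewrite qE ltcR.
have le0 (x : 'rV[R]_n) : x *m u = 0 -> (x *m A *m x^T) 0 0 <= 0.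
  move=> xu; have [->|x0] := eqVneq x 0; first by rewrite !mul0mx mxE.
  exact/ltW/negA.
have [a0|a0] := eqVneq a 0; last by rewrite ltr_wnDr ?negA ?le0.
rewrite addrC ltr_wnDr ?le0 // negA //.
by apply: contraNneq w0 => b0; rewrite defw a0 b0 !map_mx0 scaler0 addr0.
Qed.

End Diagonalization.

(** * Energy of a symmetric matrix with a single nonnegative eigenvalue *)

(** Numbers of sum zero, at most one of which is nonnegative.  The strict bound
    fails for [n = 2], where the two numbers are opposite; for larger [n] a third,
    nonzero, number makes it strict. *)
Lemma energy_one_nonneg (R : realFieldType) n (d : 'I_n -> R) : (0 < n)%N ->
  \sum_k d k = 0 ->
  (forall i j, i != j -> 0 <= d i -> d j < 0) ->
  exists m, [/\ 0 <= d m, \sum_k `|d k| = 2 * d m, forall k, `|d k| <= d m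
    & n != 2 -> forall k, k != m -> `|d k| < d m].
Proof.
move=> n_gt0 sum0 one.
have [[m dm]|neg] : (exists m, 0 <= d m) \/ (forall k, d k < 0).
  have [/existsP|/existsPn no] := boolP [exists m, 0 <= d m]; first by left.
  by right=> k; rewrite ltNge no.
- exists m.
  have negk k : k != m -> d k < 0 by rewrite eq_sym => /one; apply.
  have dmE : d m = \sum_(k | k != m) `|d k|.
    move: sum0; rewrite (bigD1 m) //= => /eqP; rewrite addr_eq0 => /eqP ->.
    by rewrite -sumrN; apply: eq_bigr => k /negk dk; rewrite ltr0_norm.
  have leP k : k != m -> `|d k| + \sum_(j | (j != m) && (j != k)) `|d j| = d m.
    by move=> km; rewrite dmE [RHS](bigD1 k).
  split=> //.
  + by rewrite (bigD1 m) //= -dmE ger0_norm // -mulr2n mulr_natl.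
  + move=> k; have [->|km] := eqVneq k m; first by rewrite ger0_norm.
    by rewrite -(leP k km) lerDl sumr_ge0.
  + move=> n2 k km; rewrite -(leP k km) ltrDl.
    have [j /andP[jm jk]] : exists j, (j != m) && (j != k).
      apply/existsP; apply: contraNT n2 => /existsPn no.
      have setTE : [set: 'I_n] = [set m; k].
        apply/setP=> j; rewrite !inE; have := no j.
        by rewrite negb_and !negbK.
      by rewrite -[n]card_ord -cardsT setTE cards2 [m == k]eq_sym km.
    rewrite (bigD1 j) ?jm //= ltr_wpDr ?sumr_ge0 // normr_gt0.
    by rewrite lt_eqF ?negk.
- have : \sum_k d k < 0.
    rewrite (bigD1 (Ordinal n_gt0)) //= ltr_wnDr // sumr_le0 // => k _.
    exact: ltW.
  by rewrite sum0 ltxx.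
Qed.

Local Notation normc := ComplexField.Normc.normc.

(** The energy bound and its equality case for any symmetric matrix with zero
    diagonal that is negative definite on the vectors of sum zero. *)
Lemma energy_row_sums (R : rcfType) n (A : 'M[R]_n)
    (r := fun i => \sum_j A i j) : (0 < n)%N ->
  A^T = A -> (forall i, A i i = 0) ->
  (forall x : 'rV[R]_n, x != 0 -> x *m (const_mx 1 : 'cV_n) = 0 ->
     (x *m A *m x^T) 0 0 < 0) ->
  2 * Num.sqrt (n%:R^-1 * \sum_i r i ^+ 2) <= energy A
  /\ (energy A = 2 * Num.sqrt (n%:R^-1 * \sum_i r i ^+ 2)
      <-> forall i j, r i = r j).
Proof.
move=> n_gt0 Asym diag0 negA; set u : 'cV[R]_n := const_mx 1 in negA.
have n0 : n%:R != 0 :> R by rewrite pnatr_eq0 -lt0n.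
have rE i : r i = (A *m u) i 0.
  by rewrite mxE; apply: eq_bigr => j _; rewrite mxE mulr1.
have [P [d [uP defA]]] := symmetric_diagonalization _ _ _ Asym.
(* [c] collects the coordinates of the all-ones vector in the eigenbasis, and
   [a] their squared moduli. *)
pose c : 'cV[R[i]]_n := P *m map_mx (real_complex R) u.
pose a k := normc (c k 0) ^+ 2.
have a_ge0 k : 0 <= a k by apply: sqr_ge0.
have suma : \sum_k a k = n%:R.
  rewrite (parseval _ _ _ uP) -[n in RHS]card_ord -sumr_const.
  by apply: eq_bigr => i _; rewrite mxE expr1n.
have sumda : \sum_k d 0 k ^+ 2 * a k = \sum_i r i ^+ 2.
  transitivity (\sum_i (A *m u) i 0 ^+ 2).
    rewrite -(parseval _ _ _ uP); apply: eq_bigr => k _.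
    rewrite (diag_coord _ _ _ _ _ uP defA) ComplexField.Normc.normcM exprMn.
    by rewrite normc_real real_normK ?num_real.
  by apply: eq_bigr => i _; rewrite rE.
(* Negative definiteness, read in the eigenbasis. *)
have negd (y : 'rV[R[i]]_n) : y != 0 -> y *m c = 0 ->
    \sum_k d 0 k * normc (y 0 k) ^+ 2 < 0.
  move=> y0 yc; rewrite -ltcR -(quadratic_form_coord _ _ _ _ _ uP defA).
  apply: (neg_def_complex _ _ _ u) => //; last by rewrite -mulmxA.
  apply: contraNneq y0 => yP.
  by rewrite -(mulmxtVK y uP) yP mul0mx.
have negc k : c k 0 = 0 -> d 0 k < 0.
  move=> ck; have -> : d 0 k = \sum_j d 0 j *
      normc ((delta_mx 0 k : 'rV[R[i]]_n) 0 j) ^+ 2.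
    rewrite (bigD1 k) //= big1 ?addr0 => [|j jk].
      by rewrite mxE !eqxx ComplexField.Normc.normc1 expr1n mulr1.
    by rewrite mxE (negPf jk) andbF ComplexField.Normc.normc0 expr0n mulr0.
  apply: negd; last by rewrite -rowE; apply/matrixP=> i j; rewrite !ord1 mxE ck mxE.
  apply/eqP=> /rowP/(_ k); rewrite !mxE !eqxx => /eqP.
  by rewrite oner_eq0.
have one i j : i != j -> 0 <= d 0 i -> d 0 j < 0.
  move=> ij di; have [cj|cj] := eqVneq (c j 0) 0; first exact: negc.
  rewrite ltNge; apply/negP=> dj.
  (* A combination of the eigenvectors [i] and [j] that is orthogonal to the
     all-ones vector. *)
  pose y : 'rV[R[i]]_n := c j 0 *: delta_mx 0 i - c i 0 *: delta_mx 0 j.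
  have : \sum_k d 0 k * normc (y 0 k) ^+ 2 < 0.
    apply: negd.
      apply: contraNneq cj => /rowP/(_ i); rewrite /y.
      by move: (c) => v; rewrite !mxE !eqxx (negPf ij) mulr0 subr0 mulr1 => ->.
    rewrite mulmxBl -!scalemxAl -!rowE; apply/matrixP=> i' k; rewrite !ord1.
    by move: (c) => v; rewrite !mxE mulrC subrr.
  apply/negP; rewrite -leNgt sumr_ge0 // => k _.
  have [->|ki] := eqVneq k i; first by rewrite mulr_ge0 ?sqr_ge0.
  have [->|kj] := eqVneq k j; first by rewrite mulr_ge0 ?sqr_ge0.
  rewrite !mxE (negPf ki) (negPf kj) !andbF !mulr0 subr0.
  by rewrite ComplexField.Normc.normc0 expr0n mulr0.
have sumd : \sum_k d 0 k = 0.
  by rewrite -(trace_diagonalization _ _ _ _ _ uP defA) /mxtrace big1.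
have [m [dm sumabs led ltd]] := energy_one_nonneg _ _ _ n_gt0 sumd one.
have enE : energy A = 2 * d 0 m.
  by rewrite (energy_diagonalization _ _ _ _ _ uP defA).
have led2 k : d 0 k ^+ 2 <= d 0 m ^+ 2.
  by rewrite -[d 0 k ^+ 2]real_normK ?num_real // ler_sqr ?nnegrE.
have sqm : d 0 m = Num.sqrt (n%:R^-1 * \sum_k d 0 m ^+ 2 * a k).
  by rewrite -mulr_sumr suma mulrCA mulVf // mulr1 sqrtr_sqr ger0_norm.
rewrite enE -sumda; split.
  rewrite ler_pM2l ?ltr0n // [leRHS]sqm ler_wsqrtr // ler_wpM2l ?invr_ge0 ?ler0n //.
  by apply: ler_sum => k _; rewrite ler_wpM2r.
split=> [eqE | reg].
- have [n2|n2] := eqVneq n 2%N.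
    move: (A) Asym diag0 @r {rE sumda}; rewrite n2 => B Bsym B0 /= i j.
    have B01 : B 0 1 = B 1 0 by rewrite -[in LHS]Bsym mxE.
    have rowB k : \sum_l B k l = B 0 1.
      rewrite !big_ord_recl big_ord0 addr0.
      rewrite (_ : lift ord0 ord0 = 1); last exact/val_inj.
      case: k => [[|[|//]] lt_k].
        by rewrite (_ : Ordinal lt_k = 0) ?B0 ?add0r //; apply/val_inj.
      by rewrite (_ : Ordinal lt_k = 1) ?B0 ?addr0 ?B01 //; apply/val_inj.
    by rewrite !rowB.
  (* Equality makes the nonnegative terms [(d_m^2 - d_k^2) a_k] vanish, so that
     the all-ones vector lies on the eigenvector [m]. *)
  have sum0 : \sum_k (d 0 m ^+ 2 - d 0 k ^+ 2) * a k = 0.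
    have pos : 0 <= n%:R^-1 * \sum_k d 0 k ^+ 2 * a k.
      rewrite mulr_ge0 ?invr_ge0 ?ler0n ?sumr_ge0 // => k _.
      by rewrite mulr_ge0 ?sqr_ge0.
    have /eqP := eqE; rewrite (inj_eq (mulfI _)) ?pnatr_eq0 // => /eqP dmE.
    under eq_bigr do rewrite mulrBl.
    rewrite sumrB -mulr_sumr suma dmE sqr_sqrtr // mulrAC mulVf // mul1r.
    by rewrite subrr.
  have zero k : k != m -> c k 0 = 0.
    move=> km; apply/eqP; rewrite -normc_sqr_eq0 -/(a k).
    move/eqP: sum0; rewrite psumr_eq0 => [|j _]; last first.
      by rewrite mulr_ge0 ?subr_ge0.
    move/allP/(_ k (mem_index_enum k)); rewrite mulf_eq0 subr_eq0 /=.
    case/orP=> // /eqP dmk; have := ltd n2 k km.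
    by rewrite -ltr_sqr ?nnegrE // real_normK ?num_real // dmk ltxx.
  have Au : A *m u = d 0 m *: u.
    apply: (map_mx_inj (f := real_complex R)).
    rewrite -[LHS](mulKmx (unitarymx_unit uP)) -[RHS](mulKmx (unitarymx_unit uP)).
    congr (_ *m _); apply/colP=> k; rewrite (diag_coord _ _ _ _ _ uP defA) -/c.
    rewrite map_mxZ -scalemxAr -/c [RHS]mxE.
    by have [->//|/zero ->] := eqVneq k m; rewrite !mulr0.
  by move=> i j; rewrite !rE Au !mxE.
- (* The index [m] is irrelevant here: [x] is the common row sum. *)
  pose x := r m.
  have Au : A *m u = x *: u.
    by apply/colP=> i; rewrite -rE (reg i m) !mxE mulr1.
  have dx : d 0 m = x.
    (* The eigenvector [m] is not orthogonal to the all-ones vector. *)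
    have cm : c m 0 != 0 by apply/eqP=> /negc; rewrite ltNge dm.
    apply: (@complexI R); apply: (mulIf cm).
    rewrite -(diag_coord _ _ _ _ _ uP defA) Au map_mxZ -scalemxAr -/c.
    by rewrite [LHS]mxE.
  congr (_ * _); rewrite sumda dx.
  rewrite (eq_bigr (fun=> x ^+ 2)) => [|i _]; last by rewrite (reg i m).
  rewrite sumr_const card_ord -[_ ^+ 2 *+ n]mulr_natl mulKf //.
  by rewrite sqrtr_sqr ger0_norm // -dx.
Qed.

(** * The resistance matrix of a connected graph *)

Section GraphResistance.
Variables (R : rcfType) (n : nat) (e : rel 'I_n).
Hypothesis e_sym : symmetric e.
Local Notation L := (laplacian R e).
Local Notation X := (mpinv L).

Lemma laplacian_tr : L^T = L.
Proof.
rewrite /laplacian linearB /= tr_diag_mx; congr (_ - _).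
by apply/matrixP=> i j; rewrite !mxE e_sym.
Qed.

(** The transpose of [X] satisfies the Penrose equations for [L^T = L]. *)
Lemma mpinv_laplacian_tr : X^T = X.
Proof.
have [LXL XLX LXt XLt] := mpinvP L.
apply: (@moore_penrose_unique _ _ _ L); last exact: mpinvP.
split.
- by have := congr1 trmx LXL; rewrite !trmx_mul laplacian_tr mulmxA.
- by have := congr1 trmx XLX; rewrite !trmx_mul laplacian_tr mulmxA.
- by rewrite trmx_mul trmxK laplacian_tr -[LHS]XLt trmx_mul laplacian_tr.
- by rewrite trmx_mul trmxK laplacian_tr -[LHS]LXt trmx_mul laplacian_tr.
Qed.

Lemma laplacian_form (x : 'rV[R]_n) :
  2 * (x *m L *m x^T) 0 0
    = \sum_i \sum_j (e i j)%:R * (x 0 i - x 0 j) ^+ 2.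
Proof.
have degE i : (#|[set j | e i j]|)%:R = \sum_j (e i j)%:R :> R.
  rewrite -sum1dep_card natr_sum big_mkcond /=.
  by apply: eq_bigr => j _; case: (e i j).
have formE : (x *m L *m x^T) 0 0 =
    \sum_i \sum_j (e i j)%:R * x 0 i ^+ 2
    - \sum_i \sum_j (e i j)%:R * (x 0 i * x 0 j).
  rewrite /laplacian mulmxBr mulmxBl mul_mx_diag !mxE; congr (_ - _).
    apply: eq_bigr => i _; rewrite -mulr_suml !mxE degE; ring.
  rewrite exchange_big; apply: eq_bigr => j _; rewrite !mxE mulr_suml.
  by apply: eq_bigr => i _; rewrite !mxE /=; ring.
have swap : \sum_i \sum_j (e i j)%:R * x 0 j ^+ 2 =
    \sum_i \sum_j (e i j)%:R * x 0 i ^+ 2.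
  rewrite exchange_big; apply: eq_bigr => i _; apply: eq_bigr => j _.
  by rewrite e_sym.
rewrite formE mulrBr {1}mulr_natl mulr2n -{1}swap mulr_sumr -big_split /= -sumrB.
apply: eq_bigr => i _; rewrite mulr_sumr -big_split /= -sumrB.
by apply: eq_bigr => j _; ring.
Qed.

Lemma laplacian_form_ge0 (x : 'rV[R]_n) : 0 <= (x *m L *m x^T) 0 0.
Proof.
rewrite -(pmulr_rge0 _ (ltr0n R 2)) laplacian_form.
by do 2!apply: sumr_ge0 => ? _; rewrite mulr_ge0 ?ler0n ?sqr_ge0.
Qed.

Hypothesis e_conn : connected_graph e.

(** A vector on which the Laplacian form vanishes is constant along edges, hence
    along paths. *)
Lemma laplacian_form_eq0 (x : 'rV[R]_n) :
  (x *m L *m x^T) 0 0 = 0 -> forall i j, x 0 i = x 0 j.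
Proof.
move=> form0 i j.
have edge k l : e k l -> x 0 k = x 0 l.
  move=> ekl; have /eqP := laplacian_form x; rewrite form0 mulr0 eq_sym.
  rewrite psumr_eq0 => [|? _]; last first.
    by apply: sumr_ge0 => ? _; rewrite mulr_ge0 ?ler0n ?sqr_ge0.
  move/allP/(_ k (mem_index_enum k)) => /=.
  rewrite psumr_eq0 => [|? _]; last by rewrite mulr_ge0 ?ler0n ?sqr_ge0.
  move/allP/(_ l (mem_index_enum l)) => /=.
  by rewrite ekl mul1r sqrf_eq0 subr_eq0 => /eqP.
have /connectP [p] := e_conn i j.
elim: p i => [|k p IHp] i /=; first by move=> _ ->.
by case/andP=> /edge -> path_p last_p; apply: IHp.
Qed.

Lemma constant_mul_laplacian (x : 'rV[R]_n) :
  (forall i j, x 0 i = x 0 j) -> x *m L = 0.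
Proof.
move=> xc; apply/rowP=> j; rewrite [RHS]mxE.
rewrite /laplacian mulmxBr mul_mx_diag !mxE.
rewrite -sum1dep_card natr_sum big_mkcond mulr_sumr -sumrB big1 // => i _.
rewrite !mxE (xc i j) e_sym.
by case: (e i j); rewrite ?mulr0 ?mulr1 subrr.
Qed.

(** As [X = X L X], the form of [X] at [x] is the Laplacian form at [x X].  If it
    vanishes, then [x X L = 0], so [L x^T = L (X L) x^T = 0] because [X L] is
    symmetric; thus [x] is constant, and zero since its entries sum to zero. *)
Lemma mpinv_laplacian_form_gt0 (x : 'rV[R]_n) :
  x != 0 -> x *m (const_mx 1 : 'cV_n) = 0 -> 0 < (x *m X *m x^T) 0 0.
Proof.
move=> x0 xu; have := mpinv_laplacian_tr; have := mpinvP L.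
(* Abstracting [X] prevents the rewriting of products from unfolding it. *)
move: X => Y [LYL YLY _ YLt] Yt.
have formE : x *m Y *m x^T = (x *m Y) *m L *m (x *m Y)^T.
  rewrite trmx_mul Yt mulmxA -(mulmxA x Y L).
  by rewrite -(mulmxA x (Y *m L) Y) YLY.
rewrite formE lt_def laplacian_form_ge0 andbT; apply: contraNneq x0.
move=> /laplacian_form_eq0/constant_mul_laplacian xYL.
have Lx : L *m x^T = 0.
  rewrite -[X in X *m _]LYL -!mulmxA (mulmxA Y) -YLt -trmx_mul.
  by rewrite mulmxA xYL trmx0 mulmx0.
have xc : forall i j, x 0 i = x 0 j.
  by apply: laplacian_form_eq0; rewrite -mulmxA Lx mulmx0 mxE.
apply/eqP/rowP=> i; rewrite mxE.
have /matrixP/(_ 0 0) := xu; rewrite !mxE (eq_bigr (fun=> x 0 i)).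
  rewrite sumr_const card_ord => /eqP; rewrite mulrn_eq0.
  by rewrite (gtn_eqF (leq_ltn_trans (leq0n i) (ltn_ord i))) => /eqP.
by move=> j _; rewrite mxE mulr1 (xc j i).
Qed.

(** For [x] orthogonal to the all-ones vector, the part [g u^T + u g^T] of the resistance matrix does not contribute. *)
Lemma resistance_form_lt0 (x : 'rV[R]_n) :
  x != 0 -> x *m (const_mx 1 : 'cV_n) = 0 ->
  (x *m resistance_mx R e *m x^T) 0 0 < 0.
Proof.
move=> x0 xu; set u : 'cV[R]_n := const_mx 1 in xu.
pose g : 'cV[R]_n := \col_i X i i.
have -> : resistance_mx R e = g *m u^T + u *m g^T - 2 *: X.
  by apply/matrixP=> i j; rewrite !mxE !big_ord1 !mxE mulr1 mul1r.
have := mpinv_laplacian_form_gt0 _ x0 xu; move: X => Y gt0.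
rewrite mulmxBr mulmxDr !mulmxBl mulmxDl !mulmxA xu !mul0mx addr0.
rewrite -(mulmxA _ u^T) -trmx_mul xu trmx0 mulmx0 add0r.
rewrite -scalemxAr -scalemxAl mxE oppr_lt0 mxE.
by rewrite mulr_gt0.
Qed.

Lemma resistance_mx_tr : (resistance_mx R e)^T = resistance_mx R e.
Proof.
have := mpinv_laplacian_tr; rewrite /resistance_mx; move: X => Y Yt.
by apply/matrixP=> i j; rewrite !mxE -[in Y j i]Yt mxE [Y j j + _]addrC.
Qed.

Lemma resistance_mx_diag i : resistance_mx R e i i = 0.
Proof. by rewrite mxE /= mulr_natl mulr2n subrr. Qed.

End GraphResistance.

Theorem proposition4p1 (R : realType) (n : nat) (e : rel 'I_n)
    (n_gt0 : (0 < n)%N) (e_sym : symmetric e) (e_irr : irreflexive e)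
    (e_conn : connected_graph e) :
  2 * Num.sqrt (n%:R^-1 * \sum_(i < n) resistance_degree R e i ^+ 2)
    <= resistance_energy R e
  /\ (resistance_energy R e
        = 2 * Num.sqrt (n%:R^-1 * \sum_(i < n) resistance_degree R e i ^+ 2)
      <-> resistance_regular R e).
Proof.
apply: energy_row_sums => //.
- exact: resistance_mx_tr.
- exact: resistance_mx_diag.
- exact: resistance_form_lt0.
Qed.
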